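(* For each $n<\omega$, every formula $A\in\mathcal{F}^\nabla_n$ is equivalent in $\mathrm{RC}^\nabla$ to a formula of the form $\nabla_nA_n\land\nabla_{n+1}A_{n+1}\land\dots\land\nabla_{n+k}A_{n+k}$ for some $k<\omega$, where $A_i\in\mathcal{W}_i$ for all $i=n,\dots,n+k$.
   Context: Strictly positive formulas are built from propositional variables and $\top$ by $\land$ and unary modalities $\Diamond_n,\nabla_n$ ($n<\omega$). $\mathcal{F}^\nabla_n$ is the set of variable-free strictly positive formulas using only modalities $\Diamond_i,\nabla_i$ with $i\ge n$. A word is a formula $\Diamond_{j_1}\cdots\Diamond_{j_r}\top$ (only $\Diamond$-modalities, no $\land$); $\mathcal{W}_i$ is the set of words with all $j_s\ge i$. $\mathrm{RC}^\nabla$ is the smallest set of sequents $A\vdash B$ containing the following axioms and closed under the following rules and under substitution: (1) $A\vdash A$; $A\vdash\top$; $A\land B\vdash A$; $A\land B\vdash B$; from $A\vdash B$, $B\vdash C$ infer $A\vdash C$; from $A\vdash B$, $A\vdash C$ infer $A\vdash B\land C$; from $A\vdash B$ infer $aA\vdash aB$ for each modality $a$; (2) $aaA\vdash aA$ for each modality $a$; (3) for $m<n$: $\Diamond_nA\vdash\Diamond_mA$, $\Diamond_nA\land\Diamond_mB\vdash\Diamond_n(A\land\Diamond_mB)$, and the same two with $\nabla$ in place of $\Diamond$; (4) $A\vdash\nabla_nA$, $\Diamond_nA\vdash\nabla_nA$; (5) for $m\le n$: $\Diamond_m\nabla_nA\vdash\Diamond_mA$, $\nabla_n\Diamond_mA\vdash\Diamond_mA$.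 Equivalence means provability of both directions. *)

(* Defs.v *)
From mathcomp Require Import all_boot.

Set Implicit Arguments.
Unset Strict Implicit.
Unset Printing Implicit Defensive.

Variant kind := KDiamond | KNabla.

(* Strictly positive formulas; a modality is a kind together with an index. *)
Inductive form :=
| Var of nat
| Top
| And of form & form
| Mod of kind & nat & form.

Notation Diamond := (Mod KDiamond).
Notation Nabla := (Mod KNabla).

Fixpoint subst (s : nat -> form) (A : form) : form :=
  match A with
  | Var p => s p
  | Top => Top
  | And B C => And (subst s B) (subst s C)
  | Mod a n B => Mod a n (subst s B)
  end.

Reserved Notation "A |-- B" (at level 70, no associativity).

Inductive RCnabla : form -> form -> Prop :=
| rc_refl A : A |-- A
| rc_top A : A |-- Top
| rc_andl A B : And A B |-- A
| rc_andr A B : And A B |-- B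
| rc_trans A B C : A |-- B -> B |-- C -> A |-- C
| rc_and A B C : A |-- B -> A |-- C -> A |-- And B C
| rc_mono a n A B : A |-- B -> Mod a n A |-- Mod a n B
| rc_4 a n A : Mod a n (Mod a n A) |-- Mod a n A
| rc_lower a m n A : m < n -> Mod a n A |-- Mod a m A
| rc_J a m n A B : m < n ->
    And (Mod a n A) (Mod a m B) |-- Mod a n (And A (Mod a m B))
| rc_nabla_intro n A : A |-- Nabla n A
| rc_diamond_nabla n A : Diamond n A |-- Nabla n A
| rc_diamond_absorb m n A : m <= n -> Diamond m (Nabla n A) |-- Diamond m A
| rc_nabla_absorb m n A : m <= n -> Nabla n (Diamond m A) |-- Diamond m A
| rc_subst s A B : A |-- B -> subst s A |-- subst s B
where "A |-- B" := (RCnabla A B).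

Definition RC_equiv (A B : form) : Prop := (A |-- B) /\ (B |-- A).

(* [closed_from n] is the set F^nabla_n. *)
Fixpoint closed_from (n : nat) (A : form) : bool :=
  match A with
  | Var _ => false
  | Top => true
  | And B C => closed_from n B && closed_from n C
  | Mod _ i B => (n <= i) && closed_from n B
  end.

(* [word_from i] is the set W_i. *)
Fixpoint word_from (i : nat) (A : form) : bool :=
  match A with
  | Top => true
  | Mod KDiamond j B => (i <= j) && word_from i B
  | _ => false
  end.

(* Nabla_n A_n /\ ... /\ Nabla_{n+k} A_{n+k}, associated to the left, with
   k + 1 conjuncts and no trailing Top. *)
Fixpoint nabla_conj (W : nat -> form) (n k : nat) : form :=
  match k with
  | 0 => Nabla n (W n)
  | k'.+1 => And (nabla_conj W n k') (Nabla (n + k) (W (n + k)))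
  end.

(* Main.v *)
(** Every [A] in F^nabla_n is brought to a conjunction
    [Nabla_n A_n /\ Nabla_{n+1} A_{n+1} /\ ...] of words which is moreover "fat":
    [A_i |-- Nabla_{i+1} A_{i+1}].  For a fat normal form [X] one has
    [Nabla_n X = Nabla_n A_n], hence also [Diamond_n X = Diamond_n A_n], because
    [Diamond_n] absorbs [Nabla_n].  For [m > n] the first conjunct of
    [X = Nabla_n A_n /\ Y] moves out of a modality:
    [Nabla_m X = Nabla_n A_n /\ Nabla_m Y] and
    [Diamond_m X = Diamond_n A_n /\ Diamond_m Y].
    Fatness is restored by writing [A_n] as [B /\ T] with [B] in W_{n+1} and [T]
    either [Top] or of the form [Diamond_n D]: if [B] does not already imply
    [Nabla_{n+1} A_{n+1}], then [B] may be replaced by [A_{n+1}].  This, like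
    the case of conjunction, rests on the linearity of the words of W_n. *)

Require Import Defs.
From mathcomp Require Import all_boot.
From mathcomp Require Import zify.

Set Implicit Arguments.
Unset Strict Implicit.
Unset Printing Implicit Defensive.

(** * Derived rules of the calculus *)

Lemma and_l A B C : A |-- C -> And A B |-- C.
Proof. exact: rc_trans (rc_andl _ _). Qed.

Lemma and_r A B C : B |-- C -> And A B |-- C.
Proof. exact: rc_trans (rc_andr _ _). Qed.

Lemma and_mono A A' B B' : A |-- A' -> B |-- B' -> And A B |-- And A' B'.
Proof. by move=> hA hB; apply: rc_and; [apply: and_l|apply: and_r]. Qed.

Lemma equiv_refl A : RC_equiv A A.
Proof. by split; exact: rc_refl. Qed.

Lemma equiv_sym A B : RC_equiv A B -> RC_equiv B A.
Proof. by case. Qed.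

Lemma equiv_trans A B C : RC_equiv A B -> RC_equiv B C -> RC_equiv A C.
Proof. by move=> [h1 h2] [h3 h4]; split; [apply: rc_trans h3|apply: rc_trans h2]. Qed.

Lemma equiv_and A A' B B' :
  RC_equiv A A' -> RC_equiv B B' -> RC_equiv (And A B) (And A' B').
Proof. by move=> [h1 h2] [h3 h4]; split; apply: and_mono. Qed.

Lemma equiv_mod a n A B : RC_equiv A B -> RC_equiv (Mod a n A) (Mod a n B).
Proof. by move=> [h1 h2]; split; apply: rc_mono. Qed.

Lemma equiv_andA A B C : RC_equiv (And A (And B C)) (And (And A B) C).
Proof.
split; apply: rc_and.
- by apply: and_mono; [exact: rc_refl|exact: rc_andl].
- by apply/and_r/rc_andr.
- by apply/and_l/rc_andl.
- by apply: and_mono; [exact: rc_andr|exact: rc_refl].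
Qed.

Lemma equiv_andACA A B C D :
  RC_equiv (And (And A B) (And C D)) (And (And A C) (And B D)).
Proof.
by split; apply: rc_and; apply: and_mono; by [exact: rc_andl|exact: rc_andr].
Qed.

Lemma equiv_and_topl A : RC_equiv A (And Top A).
Proof.
split; last exact: rc_andr.
by apply: rc_and; [exact: rc_top|exact: rc_refl].
Qed.

Lemma lower_le a m n A : m <= n -> Mod a n A |-- Mod a m A.
Proof. by rewrite leq_eqVlt => /predU1P[->|/rc_lower//]; exact: rc_refl. Qed.

(** The inner [Nabla n] is lowered to [Nabla m] and merges with the outer one by axiom (2). *)
Lemma nabla_cut m n A B : m <= n -> A |-- Nabla n B -> Nabla m A |-- Nabla m B.
Proof.
move=> le_mn h; apply: rc_trans (rc_4 _ _ _); apply: rc_mono.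
exact: rc_trans h (lower_le _ _ le_mn).
Qed.

Lemma diamond_cut m n A B : m <= n -> A |-- Nabla n B -> Diamond m A |-- Diamond m B.
Proof. by move=> le_mn h; apply: rc_trans (rc_diamond_absorb _ le_mn); apply: rc_mono. Qed.

Lemma nabla_diamond n A : RC_equiv (Nabla n (Diamond n A)) (Diamond n A).
Proof. by split; [exact: rc_nabla_absorb|exact: rc_nabla_intro]. Qed.

Lemma mod_diamond a m n A : m <= n -> Mod a n (Diamond m A) |-- Diamond m A.
Proof.
case: a => [le_mn|]; last exact: rc_nabla_absorb.
exact: rc_trans (lower_le _ _ le_mn) (rc_4 _ _ _).
Qed.

(** * Words: splitting and linearity *)

Definition tail (n : nat) (T : form) : Prop :=
  T = Top \/ exists2 D, word_from n D & T = Diamond n D.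

(** Inwards, this is the polymodal axiom [rc_J]. For [Nabla] it needs a [Nabla m] in front of the
    tail, which is inserted first and absorbed afterwards. *)
Lemma mod_tail a m n A T : tail m T -> m < n ->
  RC_equiv (Mod a n (And A T)) (And (Mod a n A) T).
Proof.
move=> tailT lt_mn; split.
  apply: rc_and; first exact/rc_mono/rc_andl.
  apply: (rc_trans (rc_mono _ _ (rc_andr A T))).
  case: tailT => [->|[D _ ->]]; first exact: rc_top.
  exact/mod_diamond/ltnW.
case: tailT => [->|[D _ ->]].
  by apply/and_l/rc_mono/rc_and; [exact: rc_refl|exact: rc_top].
case: a; first exact: rc_J.
apply: rc_trans (and_mono (rc_refl _) (rc_nabla_intro m _)) _.
apply: rc_trans (rc_J _ _ _ lt_mn) _.
by apply/rc_mono/and_mono; [exact: rc_refl|exact: rc_nabla_absorb].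
Qed.

Lemma nabla_tail n T : tail n T -> Nabla n T |-- T.
Proof. by case=> [->|[D _ ->]]; [exact: rc_top|exact: rc_nabla_absorb]. Qed.

Lemma word_cat n C T : word_from n.+1 C -> tail n T ->
  exists2 A, word_from n A & RC_equiv A (And C T).
Proof.
move=> wC tailT; elim: C wC => [//|_||[] // j C IH] /=.
- exists T; first by case: tailT => [->|[D wD ->]] //=; rewrite leqnn.
  exact: equiv_and_topl.
- by [].
- move=> /andP[lt_nj /IH[A wA eqA]]; exists (Diamond j A) => /=.
    by rewrite (ltnW lt_nj).
  exact: equiv_trans (equiv_mod _ _ eqA) (mod_tail _ _ tailT lt_nj).
Qed.

(* Decreases both when a word is shortened and when [n] is raised. *)
Fixpoint weight (n : nat) (A : form) : nat :=
  match A with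
  | Mod _ j B => (j.+1 - n) + weight n B
  | _ => 0
  end.

(** The word is cut at its first [Diamond n]. The two weight bounds feed the induction of
    [word_trichotomy]; the predecessor makes the first one strict once the weight is positive. *)
Lemma word_split n A : word_from n A ->
  exists B T, [/\ word_from n.+1 B, tail n T, RC_equiv A (And B T),
    weight n.+1 B <= (weight n A).-1
    & forall D, T = Diamond n D -> weight n D < weight n A].
Proof.
elim: A => [//|_||[] // j A IH] /=.
- by exists Top, Top; split=> //; [left|exact: equiv_and_topl].
- by [].
- case/andP; rewrite leq_eqVlt => /predU1P[<-|lt_nj] wA.
    exists Top, (Diamond n A); split=> //=; last by move=> _ [<-]; lia.
      by right; exists A.
    exact: equiv_and_topl.
  have [B [T [wB tailT eqA leB ltT]]] := IH wA.
  exists (Diamond j B), T; split=> //=.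
  + by rewrite lt_nj.
  + exact: equiv_trans (equiv_mod _ _ eqA) (mod_tail _ _ tailT lt_nj).
  + lia.
  + by move=> D /ltT; lia.
Qed.

Lemma word_weight0 n A : word_from n A -> weight n A = 0 -> A = Top.
Proof. by case: A => // -[] // j A /= /andP[le_nj _]; lia. Qed.

(** Induction on the total weight. Each word is compared with the tail of the other; if both tails
    are implied, the heads are compared in W_{n+1} and the tails put back. *)
Lemma word_trichotomy n B C : word_from n B -> word_from n C ->
  [\/ B |-- Diamond n C, C |-- Diamond n B
    | B |-- Nabla n C /\ C |-- Nabla n B].
Proof.
have [s] := ubnP (weight n B + weight n C).
elim: s n B C => // s IH n B C lt_s wB wC.
have [wt0|wt_gt0] := posnP (weight n B + weight n C).
  move/eqP: wt0; rewrite addn_eq0 => /andP[/eqP wtB /eqP wtC].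
  rewrite (word_weight0 wB wtB) (word_weight0 wC wtC).
  by apply: Or33; split; exact: rc_nabla_intro.
have tail_below B' C' U :
    weight n B' + weight n C' < s.+1 -> word_from n B' -> C' |-- U -> tail n U ->
    (forall D, U = Diamond n D -> weight n D < weight n C') ->
    B' |-- U \/ C' |-- Diamond n B'.
  move=> lt_s' wB' hCU [->|[E wE eqU]] ltU; first by left; exact: rc_top.
  rewrite eqU in hCU *.
  have lt_E : weight n B' + weight n E < s by have := ltU E eqU; lia.
  have [h|h|[_ h]] := IH n B' E lt_E wB' wE; [by left|right|right].
    exact: rc_trans hCU (rc_trans (rc_mono _ _ h) (rc_4 _ _ _)).
  exact: rc_trans hCU (diamond_cut (leqnn n) h).
have [B0 [S [wB0 tailS eqB leB0 ltS]]] := word_split wB.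
have [C0 [T [wC0 tailT eqC leC0 ltT]]] := word_split wC.
have hB_S : B |-- S by exact: rc_trans (proj1 eqB) (rc_andr _ _).
have hC_T : C |-- T by exact: rc_trans (proj1 eqC) (rc_andr _ _).
have [hBT|] := tail_below B C T lt_s wB hC_T tailT ltT; last by move=> h; apply: Or32.
have lt_s' : weight n C + weight n B < s.+1 by rewrite addnC.
have [hCS|] := tail_below C B S lt_s' wC hB_S tailS ltS; last by move=> h; apply: Or31.
(* The tail [V] enters the modality of level n+1 beside the head [Y0], and only then is the level
   lowered to n. *)
have gather a X X0 Y Y0 U V : RC_equiv X (And X0 U) -> RC_equiv Y (And Y0 V) ->
    tail n V -> X |-- V -> X0 |-- Mod a n.+1 Y0 -> X |-- Mod a n Y.
  move=> [eqX _] [_ eqY] tailV hXV h.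
  apply: rc_trans (rc_lower _ _ (ltnSn n)).
  apply: rc_trans (rc_mono _ _ eqY).
  apply: rc_trans (proj2 (mod_tail _ _ tailV (ltnSn n))).
  by apply: rc_and => //; apply: rc_trans eqX (and_l _ h).
have lt0_s : weight n.+1 B0 + weight n.+1 C0 < s by lia.
have [h|h|[h1 h2]] := IH n.+1 B0 C0 lt0_s wB0 wC0.
- by apply: Or31; apply: gather eqB eqC tailT hBT h.
- by apply: Or32; apply: gather eqC eqB tailS hCS h.
- by apply: Or33; split; [apply: gather eqB eqC tailT hBT h1|apply: gather eqC eqB tailS hCS h2].
Qed.

Lemma word_total n B C : word_from n B -> word_from n C ->
  B |-- Nabla n C \/ C |-- Nabla n B.
Proof.
move=> wB wC; have [h|h|[h _]] := word_trichotomy wB wC.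
- by left; exact: rc_trans h (rc_diamond_nabla _ _).
- by right; exact: rc_trans h (rc_diamond_nabla _ _).
- by left.
Qed.

(** * Fat normal forms and their closure properties *)

(** Fatness is imposed through the whole remainder [Y]; by [fat_lead] this amounts to imposing it
    through the first word of [Y]. *)
Inductive fat : nat -> form -> Prop :=
| fat_top n X : Top |-- X -> fat n X
| fat_cons n X A Y : word_from n A -> fat n.+1 Y -> A |-- Nabla n.+1 Y ->
    RC_equiv X (And (Nabla n A) Y) -> fat n X.

(** A provable formula also has a leading word, namely [Top], so later proofs need not treat it
    apart. *)
Lemma fat_inv n X : fat n X -> exists A Y,
  [/\ word_from n A, fat n.+1 Y, A |-- Nabla n.+1 Y
    & RC_equiv X (And (Nabla n A) Y)].
Proof.
case=> [{}n {}X hX|{}n {}X A Y wA fatY hAY eqX]; last by exists A, Y.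
exists Top, Top; split=> //; first exact/fat_top/rc_refl.
  exact: rc_nabla_intro.
split; last by apply: and_r.
by apply: rc_and; [apply: rc_trans (rc_top _) (rc_nabla_intro _ _)|exact: rc_top].
Qed.

Lemma fat_equiv n X X' : RC_equiv X X' -> fat n X -> fat n X'.
Proof.
move=> eqX /fat_inv[A [Y [wA fatY hAY eqA]]].
exact: fat_cons wA fatY hAY (equiv_trans (equiv_sym eqX) eqA).
Qed.

(** For the converse direction, [A] yields both [Nabla n.+1 Y] and [Nabla n A], which [rc_J] merges
    into [Nabla n.+1 X]. *)
Lemma fat_lead n X A Y : A |-- Nabla n.+1 Y -> RC_equiv X (And (Nabla n A) Y) ->
  RC_equiv (Nabla n X) (Nabla n A).
Proof.
move=> hAY [eqX eqX']; split.
  exact: nabla_cut (leqnn n) (rc_trans eqX (rc_andl _ _)).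
apply: nabla_cut (leqnSn n) _.
apply: rc_trans (rc_mono _ _ (rc_trans (rc_and (rc_andr _ _) (rc_andl _ _)) eqX')).
apply: rc_trans (rc_J _ _ _ (ltnSn n)).
by apply: rc_and; [|exact: rc_nabla_intro].
Qed.

Lemma fat_lead_mod a n X A Y : A |-- Nabla n.+1 Y ->
  RC_equiv X (And (Nabla n A) Y) -> RC_equiv (Mod a n X) (Mod a n A).
Proof.
move=> hAY /(fat_lead hAY)[h1 h2]; case: a => //; split.
  by apply: diamond_cut (leqnn n) _; apply: rc_trans (rc_nabla_intro n X) h1.
by apply: diamond_cut (leqnn n) _; apply: rc_trans (rc_nabla_intro n A) h2.
Qed.

Lemma fat_word n A : word_from n A -> fat n (Nabla n A).
Proof.
move=> wA; apply: (@fat_cons n _ A Top) => //; first exact/fat_top/rc_refl.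
  exact: rc_trans (rc_top _) (rc_nabla_intro _ _).
split; last exact: rc_andl.
by apply: rc_and; [exact: rc_refl|exact: rc_top].
Qed.

Lemma fat_and_word n A Z : word_from n A -> fat n.+1 Z -> fat n (And (Nabla n A) Z).
Proof.
move=> wA fatZ; have [C [Z' [wC _ hCZ' eqZ]]] := fat_inv fatZ.
have [leadZ leadC] := fat_lead hCZ' eqZ.
have hCZ : C |-- Nabla n.+1 Z by apply: rc_trans (rc_nabla_intro _ _) leadC.
have hZC : Z |-- Nabla n.+1 C by apply: rc_trans (rc_nabla_intro _ _) leadZ.
have [B [T [wB tailT eqA _ _]]] := word_split wA.
have hAB : A |-- B by apply: rc_trans (proj1 eqA) (rc_andl _ _).
have hAT : A |-- T by apply: rc_trans (proj1 eqA) (rc_andr _ _).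
have [hBC|hCB] := word_total wB wC.
  apply: (fat_cons wA fatZ) (equiv_refl _); apply: rc_trans hAB _.
  by apply: rc_trans hBC _; apply: nabla_cut (leqnn _) hCZ.
have [A' wA' eqA'] := word_cat wC tailT.
(* [Nabla n X] supplies the tail [T] and [Z] supplies the new head [X0] under [Nabla n.+1]. This
   serves both directions, exchanging the heads [B] and [C]. *)
have replace X X' X0 : RC_equiv X' (And X0 T) -> X |-- T -> Z |-- Nabla n.+1 X0 ->
    And (Nabla n X) Z |-- And (Nabla n X') Z.
  move=> [_ eqX'] hXT hZX0; apply: rc_and; last exact: rc_andr.
  apply: rc_trans (rc_lower _ _ (ltnSn n)).
  apply: rc_trans (rc_mono _ _ eqX').
  apply: rc_trans (proj2 (mod_tail _ _ tailT (ltnSn n))).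
  apply: rc_and; first by apply: and_r.
  by apply/and_l/(rc_trans (rc_mono _ _ hXT))/nabla_tail.
have hA'T : A' |-- T by apply: rc_trans (proj1 eqA') (rc_andr _ _).
apply: (@fat_cons _ _ A' Z) => //.
  by apply: rc_trans (proj1 eqA') (and_l _ hCZ).
split; first exact: replace eqA' hAT hZC.
apply: replace eqA hA'T _; apply: rc_trans hZC _.
exact: nabla_cut (leqnn _) hCB.
Qed.

Lemma fat_and n X X' : fat n X -> fat n X' -> fat n (And X X').
Proof.
move=> fatX; elim: fatX X' => {n X} [n X hX|n X A Y wA _ IH _ eqX] X' fatX'.
  apply: fat_equiv fatX'; split; last exact: rc_andr.
  by apply: rc_and; [apply: rc_trans (rc_top _) hX|exact: rc_refl].
have [A' [Y' [wA' fatY' _ eqX']]] := fat_inv fatX'.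
have larger B B' : B |-- Nabla n B' -> RC_equiv (Nabla n B) (And (Nabla n B) (Nabla n B')).
  move=> h; split; last exact: rc_andl.
  by apply: rc_and; [exact: rc_refl|apply: nabla_cut (leqnn n) h].
(* By linearity one of the two leading words implies [Nabla n] of the other and can stand for
   both. *)
have [B wB eqB] : exists2 B, word_from n B &
    RC_equiv (Nabla n B) (And (Nabla n A) (Nabla n A')).
  have [h|h] := word_total wA wA'; [exists A|exists A'] => //; first exact: larger.
  apply: equiv_trans (larger _ _ h) _.
  by split; apply: rc_and; [exact: rc_andr|exact: rc_andl|exact: rc_andr|exact: rc_andl].
apply: fat_equiv (fat_and_word wB (IH _ fatY')).
apply: equiv_trans (equiv_and eqB (equiv_refl _)) _.
apply: equiv_trans (equiv_sym (equiv_and eqX eqX')).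
exact: equiv_andACA.
Qed.

(** Induction on m - n: at equality only the leading word survives; otherwise the modality passes to
    the remainder, which is fat from n+1 on. *)
Lemma fat_mod a m n X : n <= m -> fat n X -> fat n (Mod a m X).
Proof.
move=> le_nm; rewrite -(subnK le_nm); move: (m - n) => d.
elim: d n X {le_nm} => [|d IH] n X /fat_inv[A [Y [wA fatY hAY eqX]]].
  apply: fat_equiv (equiv_sym (fat_lead_mod a hAY eqX)) _.
  case: a; last exact: fat_word.
  by apply: fat_equiv (nabla_diamond n A) _; apply: fat_word; rewrite /= leqnn.
rewrite addSnnS; have {IH}fatmY := IH _ _ fatY.
move: (d + n.+1) (leq_addl d n.+1) fatmY => {d} m lt_nm.
case: a => fatmY.
  (* The conjunct [Diamond n A] is itself a word and equals its own [Nabla n], so it can lead a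
     normal form. *)
  have wDA : word_from n (Diamond n A) by rewrite /= leqnn.
  apply: fat_equiv (fat_and_word wDA fatmY).
  apply: equiv_trans (equiv_and (nabla_diamond n A) (equiv_refl _)) _.
  apply: equiv_trans _ (equiv_mod KDiamond m (equiv_sym eqX)); split.
    apply: rc_trans (rc_and (rc_andr _ _) (rc_andl _ _)) _.
    apply: rc_trans (rc_J _ _ _ lt_nm) _; apply: rc_mono.
    apply: rc_and; last exact: rc_andl.
    by apply: and_r; exact: rc_diamond_nabla.
  apply: rc_and; last exact/rc_mono/rc_andr.
  apply: rc_trans (rc_mono _ _ (rc_andl _ _)) _.
  exact: rc_trans (rc_lower _ _ lt_nm) (rc_diamond_absorb _ (leqnn n)).
apply: fat_equiv (fat_and_word wA fatmY).
apply: equiv_trans _ (equiv_mod KNabla m (equiv_sym eqX)); split.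
  apply: rc_trans (rc_and (rc_andr _ _) (rc_andl _ _)) _.
  apply: rc_trans (rc_J _ _ _ lt_nm) _; apply: rc_mono.
  by apply: rc_and; [exact: rc_andr|exact: rc_andl].
apply: rc_and; last exact/rc_mono/rc_andr.
apply: rc_trans (rc_mono _ _ (rc_andl _ _)) _.
exact: rc_trans (rc_lower _ _ lt_nm) (rc_4 _ _ _).
Qed.

Lemma closed_fat n A : closed_from n A -> fat n A.
Proof.
elim: A => [//||A IHA B IHB|a m A IH] /=.
- by move=> _; apply/fat_top/rc_refl.
- by case/andP=> /IHA fatA /IHB; exact: fat_and.
- by case/andP=> le_nm /IH; exact: fat_mod.
Qed.

Lemma eq_nabla_conj W W' n k : (forall i, n <= i -> W i = W' i) ->
  nabla_conj W n k = nabla_conj W' n k.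
Proof.
by move=> eqW; elim: k => [|k /= ->]; rewrite /= eqW ?leq_addr.
Qed.

(** [nabla_conj] grows at its last conjunct whereas [fat] unfolds at the first. *)
Lemma nabla_conj_recl W n k :
  RC_equiv (nabla_conj W n k.+1) (And (Nabla n (W n)) (nabla_conj W n.+1 k)).
Proof.
elim: k => [|k IH]; first by rewrite /= addn1; exact: equiv_refl.
apply: equiv_trans (equiv_and IH (equiv_refl _)) _.
rewrite [nabla_conj W n.+1 k.+1]/= addSnnS.
exact/equiv_sym/equiv_andA.
Qed.

Theorem theorem3 (n : nat) (A : form) (hA : closed_from n A) :
  exists (k : nat) (W : nat -> form),
    (forall i : nat, n <= i <= n + k -> word_from i (W i)) /\
    RC_equiv A (nabla_conj W n k).
Proof.
elim: {hA} (closed_fat hA) => {n A} [n X hX|n X A Y wA _ [k [W [wW eqY]]] _ eqX].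
  (* At least one conjunct is required, so a provable formula becomes [Nabla n Top]. *)
  exists 0, (fun=> Top); split=> //; split.
    exact: rc_trans (rc_top _) (rc_nabla_intro _ _).
  exact: rc_trans (rc_top _) hX.
exists k.+1, (fun i => if i == n then A else W i); split=> [i /andP[le_ni le_ik]|].
  have [->//|ne_in] := eqVneq i n.
  by apply: wW; rewrite ltn_neqAle eq_sym ne_in le_ni addSnnS.
apply: equiv_trans eqX _; apply: equiv_trans _ (equiv_sym (nabla_conj_recl _ _ _)).
rewrite eqxx; apply: equiv_and (equiv_refl _) _.
rewrite -(@eq_nabla_conj W) // => i lt_ni.
by rewrite gtn_eqF.
Qed.
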